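(* Let $X$ be an SRNT graph with parameters $(k,c)$, with eigenvalues $k,\lambda_1,\lambda_2$, where $\lambda_1,\lambda_2$ have multiplicities $m_1,m_2$, and let $$K_1 = \lambda_1 \lambda_2^2 - 2\lambda_1^2 \lambda_2 - \lambda_1^2 - k\lambda_1 + k \lambda_2^2 + 2k\lambda_2,$$ $$K_2 = \lambda_1^2 \lambda_2 - 2\lambda_1 \lambda_2^2 - \lambda_2^2 - k\lambda_2 + k \lambda_1^2 + 2k\lambda_1 .$$ Then $K_1 \ge 0$, with equality if and only if $m_1 = k$, and $K_2 \ge 0$, with equality if and only if $m_2 = k$.
   Context: An SRNT graph with parameters $(k,c)$, where $k,c$ are integers with $k\ge 3$ and $k>c\ge 1$, is a finite simple non-bipartite connected graph $X$ of diameter $2$ such that: $X$ is regular of degree $k$; any two adjacent vertices have no common neighbours; any two distinct non-adjacent vertices have exactly $c$ common neighbours. The eigenvalues of its adjacency matrix are $k$ (with multiplicity $1$) and the two roots $\lambda_1>0>\lambda_2$ of $\lambda^2+c\lambda-(k-c)=0$; $m_1$ and $m_2$ denote the multiplicities of $\lambda_1$ and $\lambda_2$ as eigenvalues of the adjacency matrix. The numbers $K_1,K_2$ are called the Krein parameters. *)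

(* Defs.v *)
From mathcomp Require Import all_boot all_order all_algebra.

Set Implicit Arguments.
Unset Strict Implicit.
Unset Printing Implicit Defensive.

Import GRing.Theory Num.Theory.
Local Open Scope ring_scope.

(* Least length of an e-walk from x to y. A shortest walk has length less than
   #|T|; when there is no walk at all the value is #|T|. *)
Definition gdist (T : finType) (e : rel T) (x y : T) : nat :=
  find (fun d => [exists p : d.-tuple T, path e x p && (last x p == y)])
       (iota 0 #|T|).

Definition diameter (T : finType) (e : rel T) : nat :=
  (\max_(x : T) \max_(y : T) gdist e x y)%N.

Definition bipartite (T : finType) (e : rel T) : Prop :=
  exists A : {set T}, forall x y : T, e x y -> (x \in A) != (y \in A).

Definition common_nbrs (T : finType) (e : rel T) (x y : T) : {set T} :=
  [set z | e x z && e y z].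

(* The integers k > c >= 1 are taken in nat. *)
Record is_SRNT (T : finType) (e : rel T) (k c : nat) : Prop := IsSRNT {
  srnt_k_ge3 : (3 <= k)%N;
  srnt_c_ge1 : (1 <= c)%N;
  srnt_c_ltk : (c < k)%N;
  srnt_sym : symmetric e;
  srnt_irr : irreflexive e;
  srnt_nonbipartite : ~ bipartite e;
  srnt_connected : forall x y : T, connect e x y;
  srnt_diameter : diameter e = 2%N;
  srnt_regular : forall x : T, #|[set y | e x y]| = k;
  srnt_adjacent : forall x y : T, e x y -> #|common_nbrs e x y| = 0%N;
  srnt_nonadjacent : forall x y : T,
    x != y -> ~~ e x y -> #|common_nbrs e x y| = c
}.

Definition adjmx (R : nzRingType) (T : finType) (e : rel T) : 'M[R]_#|T| :=
  \matrix_(i, j) (e (enum_val i) (enum_val j))%:R.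

(* Geometric multiplicity; it equals the algebraic one for the real symmetric
   matrices considered here. It is 0 when a is not an eigenvalue. *)
Definition eigmult (F : fieldType) (n : nat) (A : 'M[F]_n) (a : F) : nat :=
  \rank (eigenspace A a).

Definition krein1 (R : nzRingType) (k l1 l2 : R) : R :=
  l1 * l2 ^+ 2 - 2 * l1 ^+ 2 * l2 - l1 ^+ 2 - k * l1
  + k * l2 ^+ 2 + 2 * k * l2.

Definition krein2 (R : nzRingType) (k l1 l2 : R) : R :=
  l1 ^+ 2 * l2 - 2 * l1 * l2 ^+ 2 - l2 ^+ 2 - k * l2
  + k * l1 ^+ 2 + 2 * k * l1.

(* Main.v *)
Require Import Defs.
From mathcomp Require Import all_boot all_order all_algebra.
From mathcomp Require Import ring.

Set Implicit Arguments.
Unset Strict Implicit.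
Unset Printing Implicit Defensive.

Import Order.TTheory GRing.Theory Num.Theory.
Local Open Scope ring_scope.

(** The sign of a Krein parameter is the sign of m - k, where m is the
multiplicity of the corresponding eigenvalue, so the theorem amounts to the
bound k <= m.

Write A for the adjacency matrix, J for the all-one matrix, and l, t for the
two roots, so that l + t = - c and l * t = c - k. Counting common neighbours
gives (A - t)(A - l) = c J ([adjmx_factor]). Hence the matrix
  Q = (k - l)(A - t) - c J
satisfies Q A = l Q, and it acts as the scalar (k - l)(l - t) on every
eigenvector for l, since such a vector is orthogonal to the all-one vector: Q
is a nonzero multiple of the projection onto the eigenspace of l
([eigenspace_eigproj]). Two facts about m = \rank Q follow.

- Computing m from the trace of Q, together with the vertex count
  #|T| * c = (k - l)(k - t), yields
    k K = - c t (l - t)(m - k)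
  where K is the Krein parameter attached to l ([krein1_eigmult]). The two
  Krein parameters are exchanged by swapping l and t, and since the roots have
  opposite signs, the factor - t (l - t) is positive for both orderings.

- The k rows of Q indexed by the neighbours of a vertex x are linearly
  independent, so k <= m ([valency_le_eigmult]). Neighbours of x are pairwise
  non-adjacent, because the graph has no triangle. A relation with
  coefficients v_a therefore reads (k + t) * (\sum_a v_a) = 0 in column x, and
  (k - l) t v_b + c * (\sum_a v_a) = 0 in the column of a neighbour b; as
  k + t, k - l and t are nonzero, all the v_b vanish. *)

(** With the rank factorization Q = C R, the hypothesis reads
C (R C) R = a C R; cancelling C and R gives R C = a, a scalar matrix of size
\rank Q, and R C has the trace of C R. *)
Lemma mxtrace_quasi_idem (F : fieldType) (n : nat) (Q : 'M[F]_n) (a : F) :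
  Q *m Q = a *: Q -> \tr Q = a * (\rank Q)%:R.
Proof.
move=> QQ; rewrite -[in LHS](mulmx_base Q) mxtrace_mulC.
suff -> : row_base Q *m col_base Q = a%:M.
  by rewrite mxtrace_scalar mulr_natr.
apply: (row_free_inj (row_base_free Q)).
apply: (row_full_inj (col_base_full Q)).
by rewrite /= -mulmxA mulmx_base mulmxA mulmx_base mul_scalar_mx -scalemxAr
  mulmx_base.
Qed.

Lemma sum_enum_val (V : nmodType) (T : finType) (f : T -> V) :
  \sum_(i < #|T|) f (enum_val i) = \sum_x f x.
Proof. by rewrite -[LHS](@big_enum_val V 0 +%R T T f). Qed.

Lemma adjmx_sqr_entry (R : nzRingType) (T : finType) (e : rel T)
    (i j : 'I_#|T|) : symmetric e ->
  (adjmx R e *m adjmx R e) i j = #|common_nbrs e (enum_val i) (enum_val j)|%:R.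
Proof.
move=> esym; rewrite mxE -sum1_card natr_sum.
rewrite (eq_bigr (fun l => (e (enum_val i) (enum_val l) &&
   e (enum_val j) (enum_val l))%:R)) => [|l _]; last first.
  by rewrite !mxE (esym (enum_val l)) -natrM mulnb.
rewrite (sum_enum_val (fun z => (e (enum_val i) z && e (enum_val j) z)%:R)).
rewrite [RHS]big_mkcond; apply: eq_bigr => z _.
by rewrite inE; case: ifP.
Qed.

Lemma adjmx_mul_const (R : nzRingType) (T : finType) (e : rel T) (k : nat) :
  (forall x, #|[set y | e x y]| = k) ->
  adjmx R e *m const_mx 1 = k%:R *: const_mx 1 :> 'M[R]_#|T|.
Proof.
move=> reg; apply/matrixP => i j; rewrite !mxE mulr1 -(reg (enum_val i)).
rewrite -sum1_card natr_sum [RHS]big_mkcond.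
rewrite (eq_bigr (fun l => (e (enum_val i) (enum_val l))%:R)); last first.
  by move=> l _; rewrite !mxE mulr1.
rewrite (sum_enum_val (fun z => (e (enum_val i) z)%:R)).
by apply: eq_bigr => z _; rewrite inE; case: ifP.
Qed.

Lemma const_mul_adjmx (R : comNzRingType) (T : finType) (e : rel T) (k : nat) :
    symmetric e -> (forall x, #|[set y | e x y]| = k) ->
  const_mx 1 *m adjmx R e = k%:R *: const_mx 1 :> 'M[R]_#|T|.
Proof.
move=> esym reg; apply: trmx_inj; rewrite trmx_mul linearZ /= trmx_const.
rewrite -(adjmx_mul_const R reg); congr (_ *m _).
by apply/matrixP => i j; rewrite !mxE esym.
Qed.

(** The three kinds of pairs of vertices (equal, adjacent, at distance two) give
A ^+ 2 = (k - c) - c A + c J, and l, t are the roots of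
X ^+ 2 + c X - (k - c). *)
Lemma adjmx_factor (R : comNzRingType) (T : finType) (e : rel T) (k c : nat)
    (hX : is_SRNT e k c) (l t : R) :
    l + t = - c%:R -> l * t = - (k%:R - c%:R) ->
  (adjmx R e - t%:M) *m (adjmx R e - l%:M) = c%:R *: const_mx 1.
Proof.
move=> hs hp; have hk : k%:R = c%:R - l * t by rewrite hp; ring.
have hc : c%:R = - (l + t) by rewrite hs opprK.
rewrite mulmxBl !mulmxBr !mul_scalar_mx !mul_mx_scalar.
apply/matrixP => i j.
have := adjmx_sqr_entry R i j (srnt_sym hX).
rewrite !mxE => ->; case: (eqVneq i j) => [<-|ij].
  rewrite (srnt_irr hX) /common_nbrs.
  under eq_finset => z do rewrite andbb.
  by rewrite [#|_|](srnt_regular hX (enum_val i)) hk /=; ring.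
have xy : enum_val i != enum_val j by rewrite (inj_eq enum_val_inj).
case exy: (e _ _); first by rewrite (srnt_adjacent hX exy) hc /=; ring.
by rewrite (srnt_nonadjacent hX xy (negbT exy)) /=; ring.
Qed.

(** Up to the factor (k - l) * (l - t), the orthogonal projection onto the
eigenspace of l; for the adjacency matrix A of an SRNT graph it is the
polynomial - (A - k) (A - t). *)
Definition eigproj (R : nzRingType) (T : finType) (e : rel T) (k c : nat)
    (l t : R) : 'M[R]_#|T| :=
  (k%:R - l) *: (adjmx R e - t%:M) - c%:R *: const_mx 1.

Lemma eigprojE (R : nzRingType) (T : finType) (e : rel T) (k c : nat)
    (l t : R) i j :
  eigproj e k c l t i j =
  (k%:R - l) * ((e (enum_val i) (enum_val j))%:R - t *+ (i == j)) - c%:R.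
Proof. by rewrite !mxE mulr1. Qed.

Section Eigenvalue.

Context (F : numFieldType) (T : finType) (e : rel T) (k c : nat).
Context (hX : is_SRNT e k c) (l t : F).
Hypotheses (hs : l + t = - c%:R) (hp : l * t = - (k%:R - c%:R)).

Lemma int_c_eigen : c%:R = - (l + t) :> F.
Proof. by rewrite hs opprK. Qed.

Lemma valency_eigen : k%:R = - (l + t) - l * t :> F.
Proof. by rewrite hp hs; ring. Qed.

Let A := adjmx F e.
Let Q := eigproj e k c l t.
Let J : 'M[F]_#|T| := const_mx 1.

(** The quadratic with roots l and t takes the positive value
k ^+ 2 + c k - k + c at k. *)
Lemma valency_sub_eigen_neq0 : k%:R - l != 0.
Proof.
apply/eqP => /subr0_eq kl.
have : k%:R * k%:R + c%:R * k%:R + c%:R = k%:R :> F.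
  by rewrite int_c_eigen [RHS]valency_eigen -kl; ring.
apply/eqP; rewrite -!natrM -!natrD eqr_nat.
have k3 := srnt_k_ge3 hX; rewrite neq_ltn; apply/orP; right.
by rewrite -addnA ltn_addr// ltn_Pmulr// (leq_trans _ k3).
Qed.

(** At - k the quadratic takes the value (k - 1) (k - c), and l + t = - c turns
its factor - k - l into t - (k - c). *)
Lemma valency_add_eigen_neq0 : k%:R + t != 0.
Proof.
have hk : (k%:R + t) * (k%:R - c%:R - t) = (k%:R - 1) * (k%:R - c%:R) :> F.
  by rewrite valency_eigen int_c_eigen; ring.
have k3 := srnt_k_ge3 hX; have ck := srnt_c_ltk hX.
apply: contraTneq isT => h; move: hk; rewrite h mul0r => /esym/eqP.
rewrite mulf_eq0 !subr_eq0 eqr_nat pnatr_eq1.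
by rewrite !gtn_eqF// (leq_trans _ k3).
Qed.

(** Any M with M A = l M satisfies M J = 0, because A J = k J and k differs
from l; on such M, Q then acts as (k - l) (A - t), that is as a nonzero scalar.
Applied to Q itself and to the eigenspace, this gives both claims. *)
Lemma eigenspace_eigproj : l != t ->
  (eigenspace A l :=: Q)%MS /\ Q *m Q = ((k%:R - l) * (l - t)) *: Q.
Proof.
move=> lt0; have kl := valency_sub_eigen_neq0.
have QA : Q *m A = l *: Q.
  have := adjmx_factor hX hs hp; rewrite mulmxBr mul_mx_scalar => AA.
  rewrite /Q /eigproj mulmxBl -!scalemxAl.
  rewrite (const_mul_adjmx _ (srnt_sym hX) (srnt_regular hX)).
  rewrite -/A in AA *.
  rewrite (canRL (subrK _) AA).
  apply/matrixP => i j; rewrite !mxE; ring.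
have mulQ (m : nat) (M : 'M[F]_(m, #|T|)) : M *m A = l *: M ->
    M *m Q = ((k%:R - l) * (l - t)) *: M.
  move=> MA; have MJ : M *m J = 0.
    apply/eqP; have := congr1 (mulmx^~ J) MA.
    rewrite /= -mulmxA (adjmx_mul_const _ (srnt_regular hX)).
    rewrite -scalemxAl -scalemxAr.
    move/eqP; rewrite -subr_eq0 -scalerBl scaler_eq0.
    by rewrite (negPf kl).
  rewrite /Q /eigproj mulmxBr -!scalemxAr MJ scaler0 subr0 mulmxBr MA.
  by rewrite mul_mx_scalar -scalerBl scalerA.
split; last exact: mulQ.
apply/eqmxP/andP; split; last exact/eigenspaceP.
have /eigenspaceP/mulQ EQ := submx_refl (eigenspace A l).
have a0 : (k%:R - l) * (l - t) != 0 by rewrite mulf_neq0// subr_eq0.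
by rewrite -(eqmx_scale _ a0) -EQ submxMl.
Qed.

(** Apply both sides of (A - t) (A - l) = c J to the all-one matrix. *)
Lemma card_vertices : (0 < #|T|)%N ->
  #|T|%:R * c%:R = (k%:R - l) * (k%:R - t) :> F.
Proof.
move=> n0.
have := congr1 (fun M => (M *m J) (Ordinal n0) (Ordinal n0))
  (adjmx_factor hX hs hp).
have AJ := adjmx_mul_const F (srnt_regular hX).
have AsJ a : (adjmx F e - a%:M) *m J = (k%:R - a) *: J.
  by rewrite mulmxBl AJ mul_scalar_mx scalerBl.
rewrite /= -mulmxA AsJ -scalemxAr AsJ -scalemxAl !mxE.
rewrite (eq_bigr (fun=> 1)) => [|i _]; last by rewrite !mxE mulr1.
by rewrite sumr_const card_ord !mulr1 mulrC => ->; ring.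
Qed.

Lemma mxtrace_eigproj :
  \tr Q = #|T|%:R * (- ((k%:R - l) * t) - c%:R).
Proof.
rewrite /mxtrace (eq_bigr (fun=> - ((k%:R - l) * t) - c%:R)) => [|i _].
  by rewrite sumr_const card_ord mulr_natl.
by rewrite eigprojE (srnt_irr hX) eqxx /=; ring.
Qed.

Lemma eigmult_formula : l != t ->
  #|T|%:R * (- ((k%:R - l) * t) - c%:R) =
  (k%:R - l) * (l - t) * (eigmult A l)%:R.
Proof.
move=> /eigenspace_eigproj[EQ QQ].
by rewrite -mxtrace_eigproj (mxtrace_quasi_idem QQ) /eigmult EQ.
Qed.

(** The identity tying the Krein parameter to the multiplicity. Eliminating
the number of vertices between [card_vertices] and [eigmult_formula] makes it a
polynomial identity in l and t, as c = - (l + t) and k = c - l t. *)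
Lemma krein1_eigmult : (0 < #|T|)%N -> l != t ->
  k%:R * krein1 k%:R l t =
  c%:R * - (t * (l - t)) * ((eigmult A l)%:R - k%:R).
Proof.
move=> n0 lt0; apply: (mulfI valency_sub_eigen_neq0).
have hn := card_vertices n0; have hm := eigmult_formula lt0.
have {hm} hm : c%:R * ((k%:R - l) * (l - t) * (eigmult A l)%:R) =
    (k%:R - l) * (k%:R - t) * (- ((k%:R - l) * t) - c%:R).
  by rewrite -hm -hn; ring.
have -> : (k%:R - l) * (c%:R * - (t * (l - t)) * ((eigmult A l)%:R - k%:R)) =
    - t * (c%:R * ((k%:R - l) * (l - t) * (eigmult A l)%:R))
    + (k%:R - l) * (c%:R * k%:R * t * (l - t)) by ring.
rewrite hm.
by rewrite /krein1 valency_eigen int_c_eigen; ring.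
Qed.

(** The rows of Q at the neighbours of a vertex x are independent: column x
shows that the coefficients of a relation have sum zero, and then the column
of a neighbour b isolates the coefficient of b. *)
Lemma valency_le_eigmult : (0 < #|T|)%N -> l != t -> (k <= eigmult A l)%N.
Proof.
move=> /card_gt0P[x _] /eigenspace_eigproj[EQ _].
have kl := valency_sub_eigen_neq0; have kt := valency_add_eigen_neq0.
rewrite /eigmult EQ -(srnt_regular hX x).
set N := [set y | e x y].
pose f (a : 'I_#|N|) : 'I_#|T| := enum_rank (enum_val a).
have fE a : enum_val (f a) = enum_val a by rewrite /f enum_rankK.
have fN (a : 'I_#|N|) : e x (enum_val a).
  by have: enum_val a \in N := enum_valP a; rewrite /N inE.
have fNN (a b : 'I_#|N|) : e (enum_val a : T) (enum_val b) = false.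
  apply/negP => eab; have /eqP := srnt_adjacent hX (fN a).
  rewrite cards_eq0 => /eqP/setP/(_ (enum_val b)).
  by rewrite !inE fN eab.
have finj : injective f by apply: inj_comp enum_rank_inj enum_val_inj.
suff /eqP <- : row_free (rowsub f Q) by rewrite rowsubE mxrankM_maxr.
apply: inj_row_free => v vQ.
have vE i : \sum_a v 0 a * Q (f a) i = 0.
  have := congr1 (fun M : 'rV_ _ => M 0 i) vQ; rewrite !mxE => {2}<-.
  by apply: eq_bigr => a _; rewrite [in RHS]mxE.
have s0 : \sum_a v 0 a = 0.
  have := vE (enum_rank x).
  rewrite (eq_bigr (fun a => v 0 a * (k%:R + t))) => [|a _]; last first.
    rewrite eigprojE fE enum_rankK (srnt_sym hX) fN.
    have /negPf -> : f a != enum_rank x.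
      rewrite (inj_eq enum_rank_inj); apply: contraTneq (fN a) => ->.
      by rewrite (srnt_irr hX).
    by congr (_ * _); rewrite /= int_c_eigen; ring.
  by rewrite -mulr_suml => /eqP; rewrite mulf_eq0 (negPf kt) orbF => /eqP.
apply/rowP => b; rewrite [RHS]mxE; have := vE (f b).
rewrite (eq_bigr (fun a => - ((k%:R - l) * t) * (if a == b then v 0 a else 0)
    - c%:R * v 0 a)); last first.
  move=> a _; rewrite eigprojE !fE fNN (inj_eq finj).
  by case: eqP => _ /=; ring.
rewrite sumrB -!mulr_sumr s0 mulr0 subr0 -big_mkcond big_pred1_eq.
have t0 : t != 0.
  apply: contra_eq_neq hp => ->; rewrite mulr0 eq_sym oppr_eq0 subr_eq0 eqr_nat.
  by rewrite gtn_eqF ?(srnt_c_ltk hX).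
by move/eqP; rewrite mulf_eq0 oppr_eq0 mulf_eq0 (negPf kl) (negPf t0) => /eqP.
Qed.

Lemma krein1_sign : (0 < #|T|)%N -> t * (l - t) < 0 ->
  let K := krein1 k%:R l t in
  0 <= K /\ (K = 0 <-> eigmult A l = k).
Proof.
move=> n0 tlt K; have lt0 : l != t.
  by apply: contraTneq tlt => ->; rewrite subrr mulr0 ltxx.
have k_gt0 : 0 < k%:R :> F by rewrite ltr0n (leq_trans _ (srnt_k_ge3 hX)).
have c_gt0 : 0 < c%:R :> F by rewrite ltr0n (srnt_c_ge1 hX).
have a_gt0 : 0 < c%:R * - (t * (l - t)) by rewrite mulr_gt0// oppr_gt0.
have kK : k%:R * K = _ := krein1_eigmult n0 lt0.
split.
  rewrite -(pmulr_rge0 _ k_gt0) kK pmulr_rge0// subr_ge0 ler_nat.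
  exact: valency_le_eigmult.
split=> [K0|mk].
  move/esym/eqP: kK; rewrite K0 mulr0 mulf_eq0 (gt_eqF a_gt0) subr_eq0 eqr_nat.
  by move/eqP.
by apply: (mulfI (lt0r_neq0 k_gt0)); rewrite kK mk subrr !mulr0.
Qed.

End Eigenvalue.

(** Over an empty vertex set the diameter, a maximum over no pairs, is 0. *)
Lemma card_SRNT_gt0 (T : finType) (e : rel T) (k c : nat) :
  is_SRNT e k c -> (0 < #|T|)%N.
Proof.
move=> hX; rewrite lt0n; apply/eqP => T0.
have := srnt_diameter hX; rewrite /diameter big_pred0// => x.
by have := fintype0 x T0.
Qed.

Lemma krein2E (R : comNzRingType) (k l t : R) : krein2 k l t = krein1 k t l.
Proof. by rewrite /krein1 /krein2; ring. Qed.

Theorem theorem4 (R : rcfType) (T : finType) (e : rel T) (k c : nat)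
  (hX : is_SRNT e k c) (l1 l2 : R)
  (hl1 : l1 ^+ 2 + c%:R * l1 - (k%:R - c%:R) = 0)
  (hl2 : l2 ^+ 2 + c%:R * l2 - (k%:R - c%:R) = 0)
  (l1_gt0 : 0 < l1) (l2_lt0 : l2 < 0) :
  let m1 := eigmult (adjmx R e) l1 in
  let m2 := eigmult (adjmx R e) l2 in
  let K1 := krein1 k%:R l1 l2 in
  let K2 := krein2 k%:R l1 l2 in
  (0 <= K1 /\ (K1 = 0 <-> m1 = k)) /\ (0 <= K2 /\ (K2 = 0 <-> m2 = k)).
Proof.
move=> m1 m2 K1 K2; have n0 := card_SRNT_gt0 hX.
have l12 : 0 < l1 - l2 by rewrite subr_gt0 (lt_trans l2_lt0).
have hs : l1 + l2 = - c%:R.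
  apply/eqP; rewrite -addr_eq0; apply/eqP/(mulfI (lt0r_neq0 l12)).
  (* (l1 - l2) * (l1 + l2 + c) is the difference of the two equations. *)
  rewrite mulr0 -[RHS](subrr 0) -{1}hl1 -hl2; ring.
have hp : l1 * l2 = - (k%:R - c%:R).
  have -> : l1 * l2 = (l1 + l2 + c%:R) * l1 - (l1 ^+ 2 + c%:R * l1) by ring.
  by rewrite hs addNr mul0r sub0r (subr0_eq hl1).
split; first by apply: (krein1_sign hX hs hp n0); rewrite nmulr_rlt0.
rewrite /K2 krein2E; apply: (krein1_sign hX) => //.
- by rewrite addrC.
- by rewrite mulrC.
- by rewrite pmulr_rlt0// -opprB oppr_lt0.
Qed.
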